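(* Let $\mathbf a=(a_1,a_2,a_3)$, $\mathbf b=(b_1,b_2,b_3)$, $\mathbf c=(c_1,c_2,c_3)$, $\mathbf d=(d_1,d_2,d_3)$, $\mathbf e=(e_1,e_2,e_3)$, $\mathbf g=(g_1,g_2,g_3)$, $\Gamma=(\gamma_1,\gamma_2,\gamma_3)$, $A=(\alpha_1,\alpha_2,\alpha_3)$, $B=(\beta_1,\beta_2,\beta_3)$ be vectors in $\mathbb{R}^3$, and let $V$ be the map given, for $\mathbf f=(f_1,f_2,f_3)\in\mathbf D$ and $k=1,2,3$, by $$V(\mathbf f)_k=a_kf_1^2+b_kf_2^2+c_kf_3^2+\alpha_kf_1f_2+\beta_kf_2f_3+\gamma_kf_1f_3+d_kf_1+e_kf_2+g_kf_3 .$$ Then $V$ maps $\mathbf S$ into itself if and only if all of the following hold: (i) $\|\mathbf a\|^2+\|\mathbf d\|^2=1$, $\|\mathbf b\|^2+\|\mathbf e\|^2=1$, $\|\mathbf c\|^2+\|\mathbf g\|^2=1$; (ii) $\|A\|=\|\mathbf a-\mathbf b\|$, $\|\Gamma\|=\|\mathbf a-\mathbf c\|$, $\|B\|=\|\mathbf b-\mathbf c\|$; (iii) $\langle\mathbf a,\mathbf d\rangle=0$, $\langle\mathbf b,\mathbf e\rangle=0$, $\langle\mathbf c,\mathbf g\rangle=0$; (iv) $\langle\mathbf a,\Gamma\rangle=\langle\mathbf c,\Gamma\rangle$, $\langle\mathbf b,B\rangle=\langle\mathbf c,B\rangle$, $\langle\mathbf a,A\rangle=\langle\mathbf b,A\rangle$;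 (v) $\langle\mathbf c,\Gamma\rangle+\langle\mathbf d,\mathbf g\rangle=0$, $\langle\mathbf c,B\rangle+\langle\mathbf e,\mathbf g\rangle=0$, $\langle\mathbf c,\mathbf d\rangle+\langle\Gamma,\mathbf g\rangle=0$, $\langle\mathbf c,\mathbf e\rangle+\langle B,\mathbf g\rangle=0$, $\langle\mathbf b,\mathbf d\rangle+\langle A,\mathbf e\rangle=0$, $\langle\mathbf b,A\rangle+\langle\mathbf d,\mathbf e\rangle=0$, $\langle\mathbf b,\mathbf g\rangle+\langle B,\mathbf e\rangle=0$, $\langle\mathbf a,\mathbf e\rangle+\langle A,\mathbf d\rangle=0$, $\langle\mathbf a,\mathbf g\rangle+\langle\Gamma,\mathbf d\rangle=0$; (vi) $\langle\mathbf a,B\rangle-\langle\mathbf c,B\rangle+\langle A,\Gamma\rangle=0$, $\langle\mathbf b,\Gamma\rangle-\langle\mathbf c,\Gamma\rangle+\langle A,B\rangle=0$, $\langle A,\mathbf g\rangle+\langle B,\mathbf d\rangle+\langle\Gamma,\mathbf e\rangle=0$, $\langle\mathbf c,A\rangle+\langle\mathbf d,\mathbf e\rangle+\langle B,\Gamma\rangle=0$.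
   Context: $\mathbf D=\{\mathbf p\in\mathbb{R}^3: p_1^2+p_2^2+p_3^2\le1\}$ is the closed unit ball and $\mathbf S=\{\mathbf p\in\mathbb{R}^3: p_1^2+p_2^2+p_3^2=1\}$ the unit sphere. $\langle\cdot,\cdot\rangle$ and $\|\cdot\|$ are the standard Euclidean scalar product and norm on $\mathbb{R}^3$. *)

(* Defs.v *)
From mathcomp Require Import all_boot all_order all_algebra.
From mathcomp Require Import classical_sets reals.

Set Implicit Arguments.
Unset Strict Implicit.
Unset Printing Implicit Defensive.

Import Order.TTheory GRing.Theory Num.Theory.

Local Open Scope ring_scope.
Local Open Scope classical_set_scope.

(* A vector of R^3 is a row vector p : 'rV[R]_3; its coordinates p_1, p_2, p_3
   are p 0 0, p 0 1, p 0 2, the indices being the elements 0, 1, 2 of 'I_3. *)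

Section Euclidean.
Variable R : realType.

Definition dotv n (u v : 'rV[R]_n) : R := \sum_(k < n) u 0 k * v 0 k.

(* The Euclidean norm; the norm `|u| that MathComp-Analysis puts on 'rV[R]_n
   is the sup norm. *)
Definition normv n (u : 'rV[R]_n) : R := Num.sqrt (dotv u u).

Definition ball3 : set 'rV[R]_3 :=
  [set p | p 0 0 ^+ 2 + p 0 1 ^+ 2 + p 0 2 ^+ 2 <= 1].

Definition sphere3 : set 'rV[R]_3 :=
  [set p | p 0 0 ^+ 2 + p 0 1 ^+ 2 + p 0 2 ^+ 2 = 1].

End Euclidean.
Arguments ball3 {R}.
Arguments sphere3 {R}.

(* Main.v *)
(* On the sphere, |V f|^2 - 1 is the sum of a quartic form (after multiplying
   the quadratic terms by |f|^2 and 1 by |f|^4) and a cubic form. Comparing f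
   with - f, both forms vanish on the sphere; by homogeneity they vanish on R^3,
   so all their coefficients are 0. These coefficient equations are linearly
   equivalent to (i)-(vi). *)
Require Import Defs.
From mathcomp Require Import all_boot all_order all_algebra.
From mathcomp Require Import ring lra.
From mathcomp Require Import classical_sets reals.

Set Implicit Arguments.
Unset Strict Implicit.
Unset Printing Implicit Defensive.

Import Order.TTheory GRing.Theory Num.Theory.

Local Open Scope ring_scope.
Local Open Scope classical_set_scope.

Definition quartic_form (R : pzRingType)
    (k400 k040 k004 k310 k220 k130 k301 k202 k103 k031 k022 k013 k211 k121
     k112 : R) (x y z : R) : R :=
  k400 * x ^+ 4 + k040 * y ^+ 4 + k004 * z ^+ 4 + k310 * x ^+ 3 * y
  + k220 * x ^+ 2 * y ^+ 2 + k130 * x * y ^+ 3 + k301 * x ^+ 3 * z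
  + k202 * x ^+ 2 * z ^+ 2 + k103 * x * z ^+ 3 + k031 * y ^+ 3 * z
  + k022 * y ^+ 2 * z ^+ 2 + k013 * y * z ^+ 3 + k211 * x ^+ 2 * y * z
  + k121 * x * y ^+ 2 * z + k112 * x * y * z ^+ 2.

Lemma quartic_form_eq0 (R : realFieldType)
    (k400 k040 k004 k310 k220 k130 k301 k202 k103 k031 k022 k013 k211 k121
     k112 : R) :
  (forall x y z, quartic_form
    k400 k040 k004 k310 k220 k130 k301 k202 k103 k031 k022 k013 k211 k121
    k112 x y z = 0) <->
  (k400 = 0 /\ k040 = 0 /\ k004 = 0 /\ k310 = 0 /\ k220 = 0 /\ k130 = 0 /\
    k301 = 0 /\ k202 = 0 /\ k103 = 0 /\ k031 = 0 /\ k022 = 0 /\ k013 = 0 /\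
    k211 = 0 /\ k121 = 0 /\ k112 = 0).
Proof.
split=> [F0|]; last first.
  by rewrite /quartic_form; do 14![case=> ->]; move=> -> x y z; ring.
(* The basis vectors isolate the pure fourth powers. In each coordinate plane, the points with
   coordinates (1, 1), (1, -1), (1, 2) determine the three mixed coefficients. The last three sign
   patterns separate [k211], [k121], [k112]. *)
move: (F0 1 0 0) (F0 0 1 0) (F0 0 0 1) (F0 1 1 0)
  (F0 1 (-1) 0) (F0 1 2 0)
  (F0 1 0 1) (F0 1 0 (-1)) (F0 1 0 2) (F0 0 1 1) (F0 0 1 (-1)) (F0 0 1 2)
  (F0 1 1 1) (F0 1 1 (-1)) (F0 1 (-1) 1).
rewrite /quartic_form {F0} => H0 H1 H2 H3 H4 H5 H6 H7 H8 H9 H10 H11 H12 H13 H14.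
by do !split; lra.
Qed.

Definition cubic_form (R : pzRingType)
    (k300 k030 k003 k210 k120 k201 k102 k021 k012 k111 : R) (x y z : R) : R :=
  k300 * x ^+ 3 + k030 * y ^+ 3 + k003 * z ^+ 3 + k210 * x ^+ 2 * y
  + k120 * x * y ^+ 2 + k201 * x ^+ 2 * z + k102 * x * z ^+ 2
  + k021 * y ^+ 2 * z + k012 * y * z ^+ 2 + k111 * x * y * z.

Lemma cubic_form_eq0 (R : realFieldType)
    (k300 k030 k003 k210 k120 k201 k102 k021 k012 k111 : R) :
  (forall x y z, cubic_form
    k300 k030 k003 k210 k120 k201 k102 k021 k012 k111 x y z = 0) <->
  (k300 = 0 /\ k030 = 0 /\ k003 = 0 /\ k210 = 0 /\ k120 = 0 /\ k201 = 0 /\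
    k102 = 0 /\ k021 = 0 /\ k012 = 0 /\ k111 = 0).
Proof.
split=> [F0|]; last first.
  by rewrite /cubic_form; do 9![case=> ->]; move=> -> x y z; ring.
(* Each coordinate plane now has only two mixed coefficients, so (1, 1) and (1, -1) suffice there;
   the point (1, 1, 1) then isolates [k111]. *)
move: (F0 1 0 0) (F0 0 1 0) (F0 0 0 1) (F0 1 1 0)
  (F0 1 (-1) 0) (F0 1 0 1)
  (F0 1 0 (-1)) (F0 0 1 1) (F0 0 1 (-1)) (F0 1 1 1).
rewrite /cubic_form {F0} => H0 H1 H2 H3 H4 H5 H6 H7 H8 H9.
by do !split; lra.
Qed.

(** Every nonzero vector is its norm times a point of the sphere, and homogeneity pulls the norm
    out. At the origin, [0 < n] makes the factor [0 ^+ n] vanish. *)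
Lemma homogeneous_sphere_eq0 (R : rcfType) (n : nat) (F : R -> R -> R -> R) :
  (0 < n)%N ->
  (forall t x y z, F (t * x) (t * y) (t * z) = t ^+ n * F x y z) ->
  (forall x y z, x ^+ 2 + y ^+ 2 + z ^+ 2 = 1 -> F x y z = 0) ->
  forall x y z, F x y z = 0.
Proof.
move=> n_gt0 homF F0 x y z; set s := x ^+ 2 + y ^+ 2 + z ^+ 2.
have s_ge0 : 0 <= s by rewrite !addr_ge0 ?sqr_ge0.
have [s0|s_neq0] := eqVneq s 0.
  have [x0 y0 z0] : [/\ x = 0, y = 0 & z = 0].
    by split; apply/eqP; rewrite -sqrf_eq0 eq_le sqr_ge0 andbT;
      move: s0 (sqr_ge0 x) (sqr_ge0 y) (sqr_ge0 z); rewrite /s; lra.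
  rewrite x0 y0 z0; move: (homF 0 0 0 0).
  by rewrite !mul0r expr0n -[n == 0%N]negbK -lt0n n_gt0 mul0r.
set t := Num.sqrt s.
have t2 : t ^+ 2 = s by rewrite sqr_sqrtr.
have t_neq0 : t != 0 by rewrite -sqrf_eq0 t2.
have scaleK u : t * (u / t) = u by rewrite mulrC divfK.
rewrite -[x]scaleK -[y]scaleK -[z]scaleK homF F0 ?mulr0 //.
by rewrite !expr_div_n -!mulrDl t2 divff.
Qed.

Lemma sphere_even_odd_eq0 (R : rcfType) (m n : nat) (F G : R -> R -> R -> R) :
  (0 < m)%N -> (0 < n)%N -> ~~ odd m -> odd n ->
  (forall t x y z, F (t * x) (t * y) (t * z) = t ^+ m * F x y z) ->
  (forall t x y z, G (t * x) (t * y) (t * z) = t ^+ n * G x y z) ->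
  (forall x y z, x ^+ 2 + y ^+ 2 + z ^+ 2 = 1 -> F x y z + G x y z = 0) ->
  (forall x y z, F x y z = 0) /\ (forall x y z, G x y z = 0).
Proof.
move=> m_gt0 n_gt0 m_even n_odd homF homG FG0.
suff FG x y z : x ^+ 2 + y ^+ 2 + z ^+ 2 = 1 -> F x y z = 0 /\ G x y z = 0.
  split; [apply: homogeneous_sphere_eq0 m_gt0 homF _
         |apply: homogeneous_sphere_eq0 n_gt0 homG _];
    by move=> x y z /FG[].
(* The antipode is written with the factor -1 so that homogeneity applies with t = -1; by parity it
   yields F - G = 0 beside F + G = 0. *)
move=> xyz; have := FG0 x y z xyz; have := FG0 (-1 * x) (-1 * y) (-1 * z).
rewrite homF homG -signr_odd (negPf m_even) -[_ ^+ n]signr_odd n_odd.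
by rewrite expr0 expr1 !mulN1r !sqrrN => /(_ xyz); split; lra.
Qed.

Section Dotv.
Variable R : realType.

Lemma dotv3E (u v : 'rV[R]_3) :
  dotv u v = u 0 0 * v 0 0 + u 0 1 * v 0 1 + u 0 2 * v 0 2.
Proof.
rewrite /dotv !big_ord_recr big_ord0 /= add0r.
by congr (_ * _ + _ * _ + _ * _); congr (fun_of_matrix _ _ _); apply: val_inj.
Qed.

Lemma dotvv_ge0 n (u : 'rV[R]_n) : 0 <= dotv u u.
Proof. by apply: sumr_ge0 => k _; rewrite -expr2 sqr_ge0. Qed.

Lemma sqr_normv n (u : 'rV[R]_n) : normv u ^+ 2 = dotv u u.
Proof. by rewrite sqr_sqrtr ?dotvv_ge0. Qed.

Lemma normv_eq n (u v : 'rV[R]_n) : normv u = normv v <-> dotv u u = dotv v v.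
Proof. by split=> [uv|]; [rewrite -!sqr_normv uv | rewrite /normv => ->]. Qed.

Lemma dotvBB (u v : 'rV[R]_3) :
  dotv (u - v) (u - v) = dotv u u - 2 * dotv u v + dotv v v.
Proof. by rewrite !dotv3E !mxE; ring. Qed.

End Dotv.

(** With s = |f|^2, this is the squared norm of the quadratic part of V, plus s times that of the
    linear part, minus s^2; the constants -1 and -2 come from s^2. *)
Definition normsq_quartic (R : realType) (a b c d e g Gamma A B : 'rV[R]_3) :
    R -> R -> R -> R :=
  quartic_form
    (dotv a a + dotv d d - 1)
    (dotv b b + dotv e e - 1)
    (dotv c c + dotv g g - 1)
    (2 * dotv a A + 2 * dotv d e)
    (2 * dotv a b + dotv A A + dotv d d + dotv e e - 2)
    (2 * dotv b A + 2 * dotv d e)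
    (2 * dotv a Gamma + 2 * dotv d g)
    (2 * dotv a c + dotv Gamma Gamma + dotv d d + dotv g g - 2)
    (2 * dotv c Gamma + 2 * dotv d g)
    (2 * dotv b B + 2 * dotv e g)
    (2 * dotv b c + dotv B B + dotv e e + dotv g g - 2)
    (2 * dotv c B + 2 * dotv e g)
    (2 * dotv a B + 2 * dotv A Gamma + 2 * dotv e g)
    (2 * dotv b Gamma + 2 * dotv A B + 2 * dotv d g)
    (2 * dotv c A + 2 * dotv B Gamma + 2 * dotv d e).

(** Twice the scalar product of the quadratic and linear parts of V. *)
Definition normsq_cubic (R : realType) (a b c d e g Gamma A B : 'rV[R]_3) :
    R -> R -> R -> R :=
  cubic_form
    (2 * dotv a d)
    (2 * dotv b e)
    (2 * dotv c g)
    (2 * dotv a e + 2 * dotv A d)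
    (2 * dotv b d + 2 * dotv A e)
    (2 * dotv a g + 2 * dotv Gamma d)
    (2 * dotv c d + 2 * dotv Gamma g)
    (2 * dotv b g + 2 * dotv B e)
    (2 * dotv c e + 2 * dotv B g)
    (2 * dotv A g + 2 * dotv B d + 2 * dotv Gamma e).

Lemma dotv_sphere_forms (R : realType) (a b c d e g Gamma A B w : 'rV[R]_3)
    (x y z : R) :
  (forall k : 'I_3,
     w 0 k =
       a 0 k * x ^+ 2 + b 0 k * y ^+ 2 + c 0 k * z ^+ 2
       + A 0 k * x * y + B 0 k * y * z + Gamma 0 k * x * z
       + d 0 k * x + e 0 k * y + g 0 k * z) ->
  x ^+ 2 + y ^+ 2 + z ^+ 2 = 1 ->
  dotv w w - 1 =
    normsq_quartic a b c d e g Gamma A B x y z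
    + normsq_cubic a b c d e g Gamma A B x y z.
Proof.
move=> wE xyz.
(* [q2] is the squared norm of the linear part. Homogenising replaces q2 - 1 by s q2 - s^2 with s =
   |f|^2, and the difference factors as (1 - s)(q2 - 1 - s). *)
pose q2 := dotv d d * x ^+ 2 + dotv e e * y ^+ 2 + dotv g g * z ^+ 2
  + 2 * (dotv d e * x * y + dotv e g * y * z + dotv d g * x * z).
(* The difference of the two sides is a multiple of 1 - |f|^2. *)
suff -> : dotv w w - 1 =
    normsq_quartic a b c d e g Gamma A B x y z
    + normsq_cubic a b c d e g Gamma A B x y z
    + (1 - (x ^+ 2 + y ^+ 2 + z ^+ 2))
      * (q2 - 1 - (x ^+ 2 + y ^+ 2 + z ^+ 2)).
  by rewrite xyz subrr mul0r addr0.
rewrite /q2 /normsq_quartic /normsq_cubic /quartic_form /cubic_form.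
by rewrite !dotv3E !wE; ring.
Qed.

Theorem theorem4p1 (R : realType)
    (a b c d e g Gamma A B : 'rV[R]_3) (V : 'rV[R]_3 -> 'rV[R]_3)
    (V_def : forall f : 'rV[R]_3, ball3 f -> forall k : 'I_3,
       V f 0 k =
         a 0 k * f 0 0 ^+ 2 + b 0 k * f 0 1 ^+ 2 + c 0 k * f 0 2 ^+ 2
         + A 0 k * f 0 0 * f 0 1 + B 0 k * f 0 1 * f 0 2
         + Gamma 0 k * f 0 0 * f 0 2
         + d 0 k * f 0 0 + e 0 k * f 0 1 + g 0 k * f 0 2) :
  V @` sphere3 `<=` sphere3 <->
  ((* i *)
   (normv a ^+ 2 + normv d ^+ 2 = 1 /\
    normv b ^+ 2 + normv e ^+ 2 = 1 /\
    normv c ^+ 2 + normv g ^+ 2 = 1) /\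
   (* ii *)
   (normv A = normv (a - b) /\
    normv Gamma = normv (a - c) /\
    normv B = normv (b - c)) /\
   (* iii *)
   (dotv a d = 0 /\ dotv b e = 0 /\ dotv c g = 0) /\
   (* iv *)
   (dotv a Gamma = dotv c Gamma /\
    dotv b B = dotv c B /\
    dotv a A = dotv b A) /\
   (* v *)
   (dotv c Gamma + dotv d g = 0 /\
    dotv c B + dotv e g = 0 /\
    dotv c d + dotv Gamma g = 0 /\
    dotv c e + dotv B g = 0 /\
    dotv b d + dotv A e = 0 /\
    dotv b A + dotv d e = 0 /\
    dotv b g + dotv B e = 0 /\
    dotv a e + dotv A d = 0 /\
    dotv a g + dotv Gamma d = 0) /\
   (* vi *)
   (dotv a B - dotv c B + dotv A Gamma = 0 /\
    dotv b Gamma - dotv c Gamma + dotv A B = 0 /\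
    dotv A g + dotv B d + dotv Gamma e = 0 /\
    dotv c A + dotv d e + dotv B Gamma = 0)).
Proof.
have forms p : sphere3 p -> (sphere3 (V p) <->
    normsq_quartic a b c d e g Gamma A B (p 0 0) (p 0 1) (p 0 2)
    + normsq_cubic a b c d e g Gamma A B (p 0 0) (p 0 1) (p 0 2) = 0).
  move=> pS; have pB : ball3 p by rewrite /ball3 /= (pS : _ = _).
  rewrite -(dotv_sphere_forms (V_def p pB) pS) dotv3E -!expr2 /sphere3 /=.
  by split=> [->|/eqP]; [rewrite subrr | rewrite subr_eq0 => /eqP].
(* Conditions (i) and (ii) become linear in the scalar products, like the others, so [lra] can treat
   these products as atoms. *)
rewrite !sqr_normv !normv_eq !dotvBB.
split=> [VS|conds].
  have [Q0 C0] :
      (forall x y z, normsq_quartic a b c d e g Gamma A B x y z = 0) /\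
      (forall x y z, normsq_cubic a b c d e g Gamma A B x y z = 0).
    apply: (@sphere_even_odd_eq0 _ 4 3) => // [t x y z|t x y z|x y z xyz].
    - by rewrite /normsq_quartic /quartic_form; ring.
    - by rewrite /normsq_cubic /cubic_form; ring.
    pose p : 'rV[R]_3 := \row_k [:: x; y; z]`_k.
    have pS : sphere3 p by rewrite /sphere3 /= !mxE.
    by have := (forms p pS).1 (VS _ (imageP V pS)); rewrite !mxE.
  move: Q0 C0 => /quartic_form_eq0 Q0 /cubic_form_eq0 C0; move: Q0 C0.
  (* For instance, (ii) is the coefficient of x^2 y^2 minus those of x^4 and y^4, and likewise in
     the other planes; (iv) compares x^3 y with x y^3; the first line of (vi) compares x^2 y z with
     y z^3. *)
  by move=> {forms VS V_def} *; do !split; lra.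
move=> _ [p pS <-]; apply/(forms p pS).
(* The same linear relations are solved backwards: (v) gives one coefficient of each pair such as
   x^3 y and x y^3, and (iv) transfers it to the other. *)
have Q0 : forall x y z, normsq_quartic a b c d e g Gamma A B x y z = 0.
  by apply/quartic_form_eq0; move: conds => {V_def forms p pS} *;
    do !split; lra.
have C0 : forall x y z, normsq_cubic a b c d e g Gamma A B x y z = 0.
  by apply/cubic_form_eq0; move: conds => {V_def forms Q0 p pS} *;
    do !split; lra.
by rewrite Q0 C0 addr0.
Qed.
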